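(* Let $\mathcal{G}'$ be the set of partitions $\lambda=(\lambda_1\ge\lambda_2\ge\cdots\ge\lambda_\ell)$ into positive parts (empty partition included) such that $\lambda_{2i-1}-\lambda_{2i}\ge3$ whenever $2i\le\ell$, $\lambda_{2i}-\lambda_{2i+1}$ is even whenever $2i+1\le\ell$, and the smallest part $\lambda_\ell$ is at least $3$ if $\ell$ is odd and is even if $\ell$ is even. For a partition let $|\lambda_o|=\lambda_1+\lambda_3+\cdots$ and $|\lambda_e|=\lambda_2+\lambda_4+\cdots$. Then $$\sum_{\lambda\in\mathcal{G}'}x^{|\lambda_{o}|}y^{|\lambda_{e}|}=\sum_{n=0}^{\infty}\frac{x^{\frac{3n^2+3n}{2}}y^{\frac{3n^2-3n}{2}}}{(x;xy)_n(x^2y^2;x^2y^2)_{n}}.$$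
   Context: $(a;t)_n=\prod_{i=0}^{n-1}(1-at^i)$; identity of formal power series in $x,y$. *)

(* Defs.v *)
From HB Require Import structures.
From mathcomp Require Import all_boot all_order all_algebra.
From mathcomp Require Import boolp classical_sets functions cardinality fsbigop.

Set Implicit Arguments.
Unset Strict Implicit.
Unset Printing Implicit Defensive.

Import GRing.Theory.

Local Open Scope ring_scope.

Record fps (R : Type) := Fps { fcoef : nat -> R }.

Lemma fpsP (R : Type) (f g : fps R) : fcoef f =1 fcoef g -> f = g.
Proof. by case: f g => [f] [g] /= /funext ->. Qed.

HB.instance Definition _ (R : Type) := gen_eqMixin (fps R).
HB.instance Definition _ (R : Type) := gen_choiceMixin (fps R).

Section FpsRing.
Variable R : comNzRingType.
Implicit Types f g h : fps R.

Definition fps_zero : fps R := Fps (fun _ => 0).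
Definition fps_opp f : fps R := Fps (fun n => - fcoef f n).
Definition fps_add f g : fps R := Fps (fun n => fcoef f n + fcoef g n).

Lemma fps_addA : associative fps_add.
Proof. by move=> f g h; apply: fpsP => n /=; rewrite addrA. Qed.

Lemma fps_addC : commutative fps_add.
Proof. by move=> f g; apply: fpsP => n /=; rewrite addrC. Qed.

Lemma fps_add0 : left_id fps_zero fps_add.
Proof. by move=> f; apply: fpsP => n /=; rewrite add0r. Qed.

Lemma fps_addN : left_inverse fps_zero fps_opp fps_add.
Proof. by move=> f; apply: fpsP => n /=; rewrite addNr. Qed.

HB.instance Definition _ :=
  GRing.isZmodule.Build (fps R) fps_addA fps_addC fps_add0 fps_addN.

Definition fps_const (c : R) : fps R :=
  Fps (fun n => if n == 0%N then c else 0).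

Definition fps_mul f g : fps R :=
  Fps (fun n => \sum_(i < n.+1) fcoef f i * fcoef g (n - i)).

Definition fps_trunc N f : {poly R} := \poly_(i < N) fcoef f i.

Lemma fps_mul_trunc N f g n : (n < N)%N ->
  fcoef (fps_mul f g) n = (fps_trunc N f * fps_trunc N g)`_n.
Proof.
move=> ltnN; rewrite coefM; apply: eq_bigr => i _.
rewrite !coef_poly (leq_ltn_trans (leq_subr _ _) ltnN).
by rewrite (leq_trans (ltn_ord i) ltnN).
Qed.

Lemma fps_mulC : commutative fps_mul.
Proof.
by move=> f g; apply: fpsP => n; rewrite !(fps_mul_trunc _ _ (ltnSn n)) mulrC.
Qed.

Lemma fps_mulA : associative fps_mul.
Proof.
move=> f g h; apply: fpsP => n.
transitivity ((fps_trunc n.+1 f * (fps_trunc n.+1 g * fps_trunc n.+1 h))`_n).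
  rewrite coefM; apply: eq_bigr => i _.
  rewrite coef_poly ltn_ord; congr (_ * _).
  by rewrite -fps_mul_trunc // ltnS leq_subr.
rewrite mulrA coefM; apply: eq_bigr => i _.
rewrite [(fps_trunc _ h)`__]coef_poly ltnS leq_subr; congr (_ * _).
by rewrite -fps_mul_trunc.
Qed.

Lemma fps_mul1 : left_id (fps_const 1) fps_mul.
Proof.
move=> f; apply: fpsP => n /=.
rewrite big_ord_recl /= subn0 mul1r big1 ?addr0 // => i _.
by rewrite /= mul0r.
Qed.

Lemma fps_mulDl : left_distributive fps_mul fps_add.
Proof.
move=> f g h; apply: fpsP => n /=; rewrite -big_split.
by apply: eq_bigr => i _; rewrite mulrDl.
Qed.

Lemma fps_one_neq0 : fps_const 1 != 0.
Proof.
by apply/eqP => /(congr1 (fun f => fcoef f 0)) /= /eqP; rewrite oner_eq0.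
Qed.

HB.instance Definition _ := GRing.Zmodule_isComNzRing.Build (fps R)
  fps_mulA fps_mulC fps_mul1 fps_mulDl fps_one_neq0.

Definition fps_var : fps R := Fps (fun n => (n == 1%N)%:R).

End FpsRing.

Arguments fps_var {R}.

Section FpsInverse.
Variable R : comUnitRingType.
Implicit Types f g : fps R.

Definition fps_unit : {pred fps R} := fun f => fcoef f 0 \is a GRing.unit.

(* The first n coefficients of f^-1, obtained by solving f * g = 1 for the
   coefficients of g one after the other. *)
Fixpoint fps_inv_seq f n : seq R :=
  if n is m.+1 then
    let s := fps_inv_seq f m in
    rcons s ((fcoef f 0)^-1
             * ((m == 0%N)%:R - \sum_(i < m) fcoef f (m - i) * s`_i))
  else [::].

(* By convention the inverse of a non-unit is itself, as in every
   [unitRingType]. *)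
Definition fps_inv f : fps R :=
  if f \in fps_unit then Fps (fun n => (fps_inv_seq f n.+1)`_n) else f.

Lemma size_fps_inv_seq f n : size (fps_inv_seq f n) = n.
Proof. by elim: n => //= n IHn; rewrite size_rcons IHn. Qed.

Lemma nth_fps_inv_seq f n i : (i < n)%N ->
  (fps_inv_seq f n)`_i = (fps_inv_seq f i.+1)`_i.
Proof.
elim: n => // n IHn; rewrite ltnS leq_eqVlt => /predU1P[-> // | ltin].
by rewrite -IHn // [in LHS]/= nth_rcons size_fps_inv_seq ltin.
Qed.

Lemma fps_mulV : {in fps_unit, left_inverse 1 fps_inv *%R}.
Proof.
move=> f fU; rewrite /fps_inv fU mulrC [LHS]fps_mulC; apply: fpsP => n /=.
rewrite big_ord_recr /= subnn nth_rcons size_fps_inv_seq ltnn eqxx.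
rewrite mulrC mulVKr //.
under eq_bigr => i _ do
  rewrite -[rcons _ _]/(fps_inv_seq f i.+1) -(nth_fps_inv_seq f (ltn_ord i)) mulrC.
by rewrite addrC subrK; case: eqP.
Qed.

Lemma fps_unitPl f g : g * f = 1 -> fps_unit f.
Proof.
move=> /(congr1 (fun h => fcoef h 0)) /=.
rewrite big_ord_recl big_ord0 /= subn0 addr0 => gf1.
by rewrite /fps_unit; apply/unitrPr; exists (fcoef g 0); rewrite mulrC.
Qed.

Lemma fps_inv_out : {in [predC fps_unit], fps_inv =1 id}.
Proof. by move=> f; rewrite inE /= /fps_inv => /negbTE ->. Qed.

HB.instance Definition _ := GRing.ComNzRing_hasMulInverse.Build (fps R)
  fps_mulV fps_unitPl fps_inv_out.

End FpsInverse.

(* Z[[x, y]] is represented as Z[[x]][[y]]: the outer variable is y. *)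

Definition fps2 := fps (fps int).

Definition fpsx : fps2 := fps_const fps_var.
Definition fpsy : fps2 := fps_var.

(* The coefficient of x^a y^b; cf. coefxyM and coefxy_monomial. *)
Definition coefxy (f : fps2) (a b : nat) : int := fcoef (fcoef f b) a.

Lemma fps2P (f g : fps2) : coefxy f =2 coefxy g -> f = g.
Proof. by move=> fg; apply: fpsP => b; apply: fpsP => a; apply: fg. Qed.

Lemma coefxyM (f g : fps2) a b : coefxy (f * g) a b =
  \sum_(i < a.+1) \sum_(j < b.+1) coefxy f i j * coefxy g (a - i) (b - j).
Proof.
rewrite exchange_big /=.
have fcoef_sum n (F : 'I_n -> fps int) :
    fcoef (\sum_(j < n) F j) a = \sum_(j < n) fcoef (F j) a.
  exact: (big_morph (fun h : fps int => fcoef h a) (fun _ _ => erefl) erefl).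
by rewrite /coefxy [fcoef (f * g) b]/= fcoef_sum.
Qed.

Lemma coefxy_monomial (m n a b : nat) :
  coefxy (fpsx ^+ m * fpsy ^+ n) a b = ((a == m) && (b == n))%:R.
Proof.
have mulX (R : comNzRingType) (f : fps R) k :
    fcoef (fps_var * f) k = if k is k'.+1 then fcoef f k' else 0.
  case: k => [|k]; rewrite /= big_ord_recl /= mul0r add0r ?big_ord0 //.
  rewrite big_ord_recl /= mul1r subSS subn0 big1 ?addr0 // => i _.
  by rewrite mul0r.
have mulC (R : comNzRingType) (c : R) (f : fps R) k :
    fcoef (fps_const c * f) k = c * fcoef f k.
  by rewrite /= big_ord_recl /= subn0 big1 ?addr0 // => i _; rewrite mul0r.
elim: m a => [|m IHm] a.
  rewrite expr0 mul1r; elim: n b => [|n IHn] b.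
    by rewrite expr0 /coefxy; case: b; case: a.
  rewrite exprS /coefxy mulX; case: b => [|b]; first by rewrite andbF.
  exact: IHn.
rewrite exprS -mulrA /coefxy mulC mulX; case: a => [//|a]; exact: IHm.
Qed.

(* A family of formal power series has a sum when every monomial occurs in
   finitely many of its members; the sum is then taken coefficientwise. *)
Definition fps2_summable (I : choiceType) (A : set I) (F : I -> fps2) : Prop :=
  forall a b : nat, finite_set [set i | A i /\ coefxy (F i) a b <> 0].

Definition fps2_sum (I : choiceType) (A : set I) (F : I -> fps2) : fps2 :=
  Fps (fun b => Fps (fun a => \sum_(i \in A) coefxy (F i) a b)).

Definition qpoch (R : comNzRingType) (a t : R) (n : nat) : R :=
  \prod_(i < n) (1 - a * t ^+ i).

Lemma qpoch_xxy_unit n :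
  qpoch fpsx (fpsx * fpsy) n \is a GRing.unit.
Proof.
apply: rpred_prod => i _; rewrite exprMn mulrA -exprS.
by change (coefxy 1 0 0 - coefxy (fpsx ^+ i.+1 * fpsy ^+ i) 0 0 \is a GRing.unit);
  rewrite coefxy_monomial.
Qed.

Lemma qpoch_x2y2_unit n :
  qpoch (fpsx ^+ 2 * fpsy ^+ 2) (fpsx ^+ 2 * fpsy ^+ 2) n \is a GRing.unit.
Proof.
apply: rpred_prod => i _; rewrite -exprS exprMn -!exprM mulnS.
by change (coefxy 1 0 0 - coefxy (fpsx ^+ (2 + 2 * i) * fpsy ^+ (2 + 2 * i)) 0 0
    \is a GRing.unit);
  rewrite coefxy_monomial.
Qed.

Definition is_partition (l : seq nat) : bool :=
  sorted geq l && all (fun p => 0 < p)%N l.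

(* The i-th part, counted from 1. *)
Definition part (l : seq nat) (i : nat) : nat := nth 0%N l i.-1.

Definition weight_odd (l : seq nat) : nat :=
  (\sum_(1 <= i < (size l).+1 | odd i) part l i)%N.

Definition weight_even (l : seq nat) : nat :=
  (\sum_(1 <= i < (size l).+1 | ~~ odd i) part l i)%N.

(* The empty partition satisfies all the conditions: the index ranges are then
   empty, and [part [::] 0] is [0]. *)
Definition setG' : set (seq nat) :=
  [set l | [/\ is_partition l,
    forall i, (1 <= i)%N -> (2 * i <= size l)%N ->
      (3 <= part l (2 * i - 1) - part l (2 * i))%N,
    forall i, (1 <= i)%N -> (2 * i + 1 <= size l)%N ->
      ~~ odd (part l (2 * i) - part l (2 * i + 1)) &
    if odd (size l) then (3 <= part l (size l))%N
    else ~~ odd (part l (size l))]]%classic.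

(* Main.v *)
(** A partition in G' with [2n - 1] or [2n] parts, padded with a zero part in
    the first case, is determined by its [2n] successive differences, which are
    arbitrary subject to [d_(2i-1) >= 3] and [d_(2i)] even.  Each unit of
    [d_(2i-1)] contributes a factor [x^i y^(i-1)], and each unit of [d_(2i)] a
    factor [x^i y^i], so the partitions with a given [n] are enumerated by a
    product of geometric series, which is the [n]-th summand. *)
Require Import Defs.
From mathcomp Require Import all_boot all_order all_algebra.
From mathcomp Require Import boolp classical_sets functions cardinality fsbigop.
From mathcomp Require Import zify ring.

Import GRing.Theory.
Local Open Scope ring_scope.

Set Implicit Arguments.
Unset Strict Implicit.
Unset Printing Implicit Defensive.

(** * Weights and a recursive form of the conditions defining G' *)

Section Codes.

Local Open Scope nat_scope.

Lemma weight_odd_cons p l : weight_odd (p :: l) = p + weight_even l.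
Proof.
rewrite /weight_odd big_ltn_cond //= big_add1 /=; congr (_ + _).
rewrite /weight_even big_nat_cond [RHS]big_nat_cond.
by apply: eq_big => [i|[]].
Qed.

Lemma weight_even_cons p l : weight_even (p :: l) = weight_odd l.
Proof.
rewrite /weight_even big_ltn_cond //= big_add1 /=.
rewrite /weight_odd big_nat_cond [RHS]big_nat_cond.
apply: eq_big => [i|[]//]; by rewrite negbK.
Qed.

Lemma weight_odd_nil : weight_odd [::] = 0.
Proof. by rewrite /weight_odd big_nil. Qed.

Lemma weight_even_nil : weight_even [::] = 0.
Proof. by rewrite /weight_even big_nil. Qed.

(** Peels off parts two at a time. The default in [head 0 l'] acts as a zero part after a partition
    of even length, so evenness of the smallest part becomes one more difference condition. *)
Fixpoint inG' (l : seq nat) : bool :=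
  match l with
  | [::] => true
  | [:: p] => 3 <= p
  | p :: q :: l' =>
    [&& q + 3 <= p, 0 < q, head 0 l' <= q, ~~ odd (q - head 0 l') & inG' l']
  end.

Lemma seq_pair_ind (T : Type) (P : seq T -> Prop) :
  P [::] -> (forall p, P [:: p]) ->
  (forall p q l, P l -> P (p :: q :: l)) -> forall l, P l.
Proof.
move=> P0 P1 P2 l.
suff: P l /\ forall p, P (p :: l) by case.
elim: l => [|p l [Pl Ppl]]; split=> //.
by move=> q; apply: P2.
Qed.

Lemma part_consSS p q l i : 0 < i -> part [:: p, q & l] i.+2 = part l i.
Proof. by case: i. Qed.

Lemma setG'P l : setG' l <-> inG' l.
Proof.
elim/seq_pair_ind: l => [|p|p q l IHl].
- split=> // _; split=> // i.
  + by case: i => // i _; lia.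
  + by move=> _ /=; lia.
- split=> [[_ _ _ /=]//|/= p3].
  split=> //=; [|by move=> i; lia..].
  by rewrite /is_partition /= andbT; lia.
split.
- case=> /andP[srt pos] d3 dev sm /=.
  have := d3 1 isT isT; rewrite /part /= => pq3.
  move: srt pos => /= /andP[_ srt] /and3P[_ q0 pos].
  have hq : head 0 l <= q by case: l srt {IHl d3 dev sm pos} => //= r l /andP[].
  have -> /= : q + 3 <= p by lia.
  rewrite q0 hq /=; apply/andP; split.
    (* For empty [l], evenness of [q] is the condition on the smallest part; otherwise it is the
       first even-difference condition. *)
    case: l srt d3 dev sm {IHl hq pos} => [_ _ _|r l _ _ dev _] /=.
      by rewrite /part /= subn0.
    by have := dev 1 isT isT.
  apply/IHl; split.
  + by rewrite /is_partition pos (path_sorted srt).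
  + case=> // i _ Hi.
    have := d3 i.+2 isT.
    have -> : 2 * i.+2 - 1 = (2 * i.+1 - 1).+2 by lia.
    have -> : 2 * i.+2 = (2 * i.+1).+2 by lia.
    by rewrite !part_consSS; [apply; rewrite /=; lia | lia..].
  + case=> // i _ Hi.
    have := dev i.+2 isT.
    have -> : 2 * i.+2 = (2 * i.+1).+2 by lia.
    by rewrite addSn addSn !part_consSS; [apply; rewrite /=; lia | lia..].
  + move: sm; rewrite /= negbK /part /=.
    by case: (l).
- case/and5P=> pq q0 hq evq /IHl[/andP[srt pos] d3 dev sm]; split.
  + rewrite /is_partition /= q0 pos !andbT.
    have -> /= : q <= p by lia.
    have -> /= : 0 < p by lia.
    by case: l srt hq {IHl evq pos d3 dev sm} => //= r l -> ->.
  + case=> [//|[_ _|i _ /= Hi]]; first by rewrite /part /=; lia.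
    have -> : 2 * i.+2 - 1 = (2 * i.+1 - 1).+2 by lia.
    have -> : 2 * i.+2 = (2 * i.+1).+2 by lia.
    by rewrite !part_consSS; [apply: d3; lia | lia..].
  + case=> [//|[_ _|i _ /= Hi]]; first by rewrite /part /= nth0.
    have -> : 2 * i.+2 = (2 * i.+1).+2 by lia.
    by rewrite addSn addSn !part_consSS; [apply: dev; lia | lia..].
  + move: sm; rewrite /= negbK /part /=.
    case: l evq {IHl hq srt pos d3 dev} => //=.
    by rewrite subn0.
Qed.

(** * The bijection between partitions and difference codes *)

(* The pair [(m, k)] in position [i] stands for
   [lambda_(2i-1) - lambda_(2i) = m + 3] and
   [lambda_(2i) - lambda_(2i+1) = 2k]; a partition of odd length is padded
   with a zero part, which [decode] strips. *)
Fixpoint decode (r : seq (nat * nat)) : seq nat :=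
  if r is (m, k) :: r' then
    let q := head 0 (decode r') + k.*2 in
    (q + (m + 3)) :: (if q == 0 then [::] else q :: decode r')
  else [::].

Fixpoint encode (l : seq nat) : seq (nat * nat) :=
  match l with
  | [::] => [::]
  | [:: p] => [:: (p - 3, 0)]
  | p :: q :: l' => (p - q - 3, (q - head 0 l')./2) :: encode l'
  end.

(** The largest part of a nonempty code is at least 3. *)
Lemma decode_head0 r : head 0 (decode r) = 0 -> r = [::].
Proof. by case: r => // -[m k] r /=; lia. Qed.

Lemma decodeK : cancel decode encode.
Proof.
elim=> // -[m k] r IHr /=; case: eqP => [q0|/eqP q0] /=.
  (* A zero part forces an empty tail and [k = 0], so stripping it loses no information. *)
  have r0 : r = [::] by apply: decode_head0; lia.
  by move: q0; rewrite r0 /= => q0; congr [:: (_, _)]; lia.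
by rewrite IHr; congr ((_, _) :: _); lia.
Qed.

Lemma decode_inG' r : inG' (decode r).
Proof.
elim: r => // -[m k] r IHr /=; case: eqP => [q0|/eqP q0] /=; first by lia.
by rewrite IHr; lia.
Qed.

Lemma encodeK l : inG' l -> decode (encode l) = l.
Proof.
elim/seq_pair_ind: l => [|p|p q l IHl] //=.
  by move=> p3; congr [:: _]; lia.
case/and5P=> pq q0 hq evq /IHl ->.
have -> : head 0 l + ((q - head 0 l)./2).*2 = q by lia.
by case: eqP q0 => [->//|_ _]; congr (_ :: _); lia.
Qed.

(** Here [j] counts the pairs preceding [r]. The difference [m + 3] enters [j + 1] odd-indexed and
    [j] even-indexed parts; the difference [2k] enters [j + 1] of each kind. *)
Fixpoint code_odd (j : nat) (r : seq (nat * nat)) : nat :=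
  if r is (m, k) :: r' then j.+1 * (m + 3) + j.+1 * k.*2 + code_odd j.+1 r'
  else 0.

Fixpoint code_even (j : nat) (r : seq (nat * nat)) : nat :=
  if r is (m, k) :: r' then j * (m + 3) + j.+1 * k.*2 + code_even j.+1 r'
  else 0.

(** Raising the offset counts every difference once more, and the differences add up to the largest
    part. *)
Lemma code_oddS j r : code_odd j.+1 r = code_odd j r + head 0 (decode r).
Proof. by elim: r j => //= -[m k] r IHr j /=; rewrite IHr; lia. Qed.

Lemma code_evenS j r : code_even j.+1 r = code_even j r + head 0 (decode r).
Proof. by elim: r j => //= -[m k] r IHr j /=; rewrite IHr; lia. Qed.

Lemma weight_decode r :
  weight_odd (decode r) = code_odd 0 r /\
  weight_even (decode r) = code_even 0 r.
Proof.
elim: r => [|[m k] r [IHo IHe]] /=.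
  by rewrite weight_odd_nil weight_even_nil.
rewrite weight_odd_cons weight_even_cons code_oddS code_evenS.
case: eqP => [q0|_].
  have r0 : r = [::] by apply: decode_head0; lia.
  by move: q0; rewrite r0 weight_odd_nil weight_even_nil /=; lia.
by rewrite weight_odd_cons weight_even_cons IHo IHe; lia.
Qed.

(** Each pair contributes at least 3. This bounds the length of a code by its [x]-exponent, which
    makes the sums over lengths finite in each degree. *)
Lemma size_code_odd j r : size r <= code_odd j r.
Proof. by elim: r j => //= -[m k] r IHr j /=; have := IHr j.+1; lia. Qed.

End Codes.

(** * Generating functions of weighted sets *)

(** Says that [f] is the generating function of [A] for the weights [u] and [v]; the list [s] also
    records that each bidegree is attained finitely often. *)
Definition enumerates (I : eqType) (A : pred I) (u v : I -> nat) (f : fps2) :=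
  forall a b, exists s : seq I,
  [/\ uniq s, s =i [pred i | [&& A i, u i == a & v i == b]] &
      coefxy f a b = (size s)%:R].

Lemma coefxyD f g a b : coefxy (f + g) a b = coefxy f a b + coefxy g a b.
Proof. by []. Qed.

Lemma coefxy_monomialM p q f a b :
  coefxy (fpsx ^+ p * fpsy ^+ q * f) a b =
  if ((p <= a) && (q <= b))%N then coefxy f (a - p) (b - q) else 0.
Proof.
rewrite coefxyM; case: ifP => [/andP[pa qb]|pqab].
  rewrite (bigD1 (Ordinal (pa : (p < a.+1)%N))) //=.
  rewrite (bigD1 (Ordinal (qb : (q < b.+1)%N))) //=.
  rewrite coefxy_monomial !eqxx mul1r !big1 ?addr0 // => i.
    move=> ip; apply: big1 => j _.
    rewrite coefxy_monomial -[_ == p]/(i == Ordinal (pa : (p < a.+1)%N)).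
    by rewrite (negbTE ip) mul0r.
  move=> iq; rewrite coefxy_monomial.
  rewrite -[_ == q]/(i == Ordinal (qb : (q < b.+1)%N)).
  by rewrite (negbTE iq) andbF mul0r.
apply: big1 => i _; apply: big1 => j _; rewrite coefxy_monomial.
case: andP => [[/eqP ip /eqP jq]|_]; last by rewrite mul0r.
by case/negP: (negbT pqab); rewrite -ip -jq -ltnS ltn_ord -ltnS ltn_ord.
Qed.

Lemma enumerates_map (I J : eqType) (h : I -> J) (A : pred I) (B : pred J)
    u v u' v' f :
  injective h -> (forall j, B j <-> exists2 i, A i & h i = j) ->
  u' \o h =1 u -> v' \o h =1 v ->
  enumerates A u v f -> enumerates B u' v' f.
Proof.
move=> h_inj AB u'h v'h en a b.
have [s [s_uniq mem_s ->]] := en a b.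
exists (map h s); split; [by rewrite map_inj_uniq | | by rewrite size_map].
move=> j; rewrite inE; apply/mapP/and3P => [[i + ->]|[/AB[i Ai <-] ua vb]].
  rewrite mem_s => /and3P[Ai ua vb].
  by rewrite -u'h in ua; rewrite -v'h in vb; split=> //; apply/AB; exists i.
by exists i => //; rewrite mem_s inE Ai -u'h -v'h /= ua vb.
Qed.

Lemma enumerates_disjointU (I : eqType) (A B : pred I) u v f g :
  (forall i, A i -> ~~ B i) -> enumerates A u v f -> enumerates B u v g ->
  enumerates (predU A B) u v (f + g).
Proof.
move=> AB en_f en_g a b.
have [s [s_uniq mem_s fs]] := en_f a b.
have [t [t_uniq mem_t gt]] := en_g a b.
exists (s ++ t); split.
- rewrite cat_uniq s_uniq t_uniq andbT /=; apply/hasPn => i.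
  rewrite mem_s mem_t => /and3P[Bi _ _]; rewrite inE.
  by apply: contraL Bi => /and3P[/AB].
- move=> i; rewrite mem_cat mem_s mem_t !inE /=.
  by case: (A i); case: (B i); rewrite /= ?orbb ?orbF.
- by rewrite coefxyD fs gt size_cat natrD.
Qed.

Lemma enumerates_monomialM (I : eqType) (A : pred I) u v f p q :
  enumerates A u v f ->
  enumerates A (fun i => p + u i)%N (fun i => q + v i)%N
    (fpsx ^+ p * fpsy ^+ q * f).
Proof.
move=> en a b; rewrite coefxy_monomialM; case: ifP => [/andP[pa qb]|pqab].
  have [s [s_uniq mem_s ->]] := en (a - p)%N (b - q)%N.
  exists s; split=> // i; rewrite mem_s !inE.
  by congr [&& _, _ & _]; apply/eqP/eqP; lia.
exists [::]; split=> // i; rewrite !inE /=; apply/esym/negbTE.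
by apply: contraFN pqab => /and3P[_ /eqP <- /eqP <-]; rewrite !leq_addr.
Qed.

(* With [g = f / (1 - x^p y^q)], the equation [g = f + x^p y^q g] reflects
   splitting the pairs [(i, k)] according to whether [k = 0]. *)
Lemma enumerates_geometric (I : eqType) (A : pred I) u v f g p q :
  (0 < p)%N -> g * (1 - fpsx ^+ p * fpsy ^+ q) = f ->
  enumerates A u v f ->
  enumerates [pred z : I * nat | A z.1] (fun z => p * z.2 + u z.1)%N
    (fun z => q * z.2 + v z.1)%N g.
Proof.
move=> p0 gf en a.
have {gf}gE : g = f + fpsx ^+ p * fpsy ^+ q * g by rewrite -gf; ring.
(* Since [p > 0], the factor [x^p] strictly lowers the [x]-degree, so strong induction on [a]
   applies. *)
elim/ltn_ind: a => a IHa b.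
have [s [s_uniq mem_s fs]] := en a b.
(* The list [t] represents the pairs with positive second component, stored lowered by one. *)
have [t [t_uniq mem_t gt]] : exists t : seq (I * nat), [/\ uniq t,
    t =i [pred z | [&& A z.1, (p * z.2.+1 + u z.1 == a)%N
                    & (q * z.2.+1 + v z.1 == b)%N]] &
    coefxy (fpsx ^+ p * fpsy ^+ q * g) a b = (size t)%:R].
  rewrite coefxy_monomialM; case: ifP => [/andP[pa qb]|pqab].
    have [|t [t_uniq mem_t ->]] := IHa (a - p)%N _ (b - q)%N; first by lia.
    exists t; split=> // i; rewrite mem_t !inE /=.
    by congr [&& _, _ & _]; apply/eqP/eqP; lia.
  exists [::]; split=> // i; rewrite !inE /=; apply/esym/negbTE.
  apply: contraFN pqab => /and3P[_ /eqP <- /eqP <-].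
  by apply/andP; split; lia.
exists (map (fun i => (i, 0%N)) s ++ map (fun z => (z.1, z.2.+1)) t); split.
- rewrite cat_uniq !map_inj_uniq ?s_uniq ?t_uniq ?andbT /=.
  + by apply/hasPn => _ /mapP[z _ ->]; apply/mapP => -[].
  + by move=> [i k] [j l] [-> ->].
  + by move=> i j [].
- case=> i [|k]; rewrite mem_cat inE /=.
  + rewrite !muln0 !add0n; transitivity (i \in s); last by rewrite mem_s.
    have -> : ((i, 0%N) \in [seq (z.1, z.2.+1) | z <- t]) = false.
      by apply/mapP => -[].
    by rewrite orbF mem_map // => ? ? [].
  + transitivity ((i, k) \in t); last by rewrite mem_t.
    have -> : ((i, k.+1) \in [seq (i, 0%N) | i <- s]) = false.
      by apply/mapP => -[].
    rewrite -[(i, k.+1)]/((fun z => (z.1, z.2.+1)) (i, k)) mem_map //.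
    by move=> [? ?] [? ?] [-> ->].
- by rewrite gE coefxyD fs gt size_cat !size_map natrD.
Qed.

(** Passes from lists to summable families: a monomial contributes 1 for each element of the list
    and 0 elsewhere. *)
Lemma fsbig_enumerated (I : choiceType) (A : pred I) u v f a b :
  enumerates A u v f ->
  let F i := fpsx ^+ u i * fpsy ^+ v i in
  finite_set [set i | A i /\ coefxy (F i) a b <> 0]%classic /\
  \sum_(i \in [set i | A i]%classic) coefxy (F i) a b = coefxy f a b.
Proof.
move=> en F; have [s [s_uniq mem_s ->]] := en a b.
have F0 i : coefxy (F i) a b <> 0 -> u i = a /\ v i = b.
  by rewrite coefxy_monomial; case: andP => [[/eqP -> /eqP ->]|].
split.
  apply: (@sub_finite_set _ _ [set` s]%classic); last exact: finite_seq.
  by move=> i /= [Ai /F0[ui vi]]; rewrite mem_s inE Ai ui vi !eqxx.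
rewrite -(@fsbig_widen _ _ _ _ [set` s]%classic).
- rewrite -fsbig_seq // big_seq (eq_bigr (fun=> 1)).
    by rewrite -big_seq big_const_seq count_predT iter_addr_0.
  move=> i; rewrite mem_s => /and3P[_ /eqP <- /eqP <-].
  by rewrite coefxy_monomial !eqxx.
- by move=> i /=; rewrite mem_s => /and3P[].
- move=> i /= [Ai] is_; apply: contrapT => /F0[ui vi]; apply: is_.
  by rewrite /= mem_s inE Ai ui vi !eqxx.
Qed.

(** * The summand as a product over the pairs of a code *)

(** The generating function of a single pair preceded by [i] others: the numerator is the obligatory
    3 in [m + 3], and the two geometric series run over [m] and [k]. *)
Definition factor (i : nat) : fps2 :=
  fpsx ^+ (3 * i.+1) * fpsy ^+ (3 * i)
  / ((1 - fpsx ^+ i.+1 * fpsy ^+ i)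
     * (1 - fpsx ^+ (2 * i.+1) * fpsy ^+ (2 * i.+1))).

Lemma unit_1Bmonomial p q :
  (0 < p)%N -> 1 - fpsx ^+ p * fpsy ^+ q \is a GRing.unit.
Proof.
case: p => // p _.
change (coefxy 1 0 0 - coefxy (fpsx ^+ p.+1 * fpsy ^+ q) 0 0 \is a GRing.unit).
by rewrite coefxy_monomial.
Qed.

(** The offset [j] is general because removing the first pair leaves a tail of offset [j + 1]. *)
Lemma enumerates_codes n j :
  enumerates [pred r | size r == n] (code_odd j) (code_even j)
    (\prod_(i < n) factor (j + i)).
Proof.
elim: n j => [|n IHn] j.
  rewrite big_ord0 => a b; rewrite -[1]mulr1 -{1}(expr0 fpsx) -(expr0 fpsy).
  rewrite coefxy_monomial.
  (* The only code of length 0 is the empty one, of bidegree [(0, 0)]. *)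
  exists (nseq ((a == 0%N) && (b == 0%N)) [::]); split.
  - by case: (_ && _).
  - case=> [|z r]; rewrite !inE mem_nseq /=; last by rewrite andbF.
    by rewrite !(eq_sym 0%N) andbT lt0b.
  - by rewrite size_nseq.
set f := \prod_(i < n) factor (j.+1 + i).
(* Starting from the tails, [g] adjoins [m] and [h] adjoins [k]. *)
pose g := f / (1 - fpsx ^+ j.+1 * fpsy ^+ j).
pose h := g / (1 - fpsx ^+ (2 * j.+1) * fpsy ^+ (2 * j.+1)).
have en_g := enumerates_geometric (ltn0Sn j)
  (divrK (unit_1Bmonomial _ (ltn0Sn j)) f : g * _ = f) (IHn j.+1).
have p_gt0 : (0 < 2 * j.+1)%N by [].
have en_h := enumerates_geometric p_gt0
  (divrK (unit_1Bmonomial _ p_gt0) g : h * _ = g) en_g.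
have := enumerates_monomialM (3 * j.+1) (3 * j) en_h.
have -> : fpsx ^+ (3 * j.+1) * fpsy ^+ (3 * j) * h =
    \prod_(i < n.+1) factor (j + i).
  rewrite big_ord_recl /= addn0 (eq_bigr (fun i : 'I_n => factor (j.+1 + i))).
    rewrite -/f /h /g /factor invrM ?unit_1Bmonomial //; ring.
  by move=> i _; rewrite addnS.
apply: (enumerates_map (h := fun z : seq (nat * nat) * nat * nat =>
  (z.1.2, z.2) :: z.1.1)).
- by move=> [[r m] k] [[r' m'] k'] /= [-> -> ->].
- move=> r; split=> [|[[[r' m] k]]] /=; last by move=> /eqP <- <-.
  by case: r => // -[m k] r; exists (r, m, k).
- by move=> [[r m] k] /=; rewrite -mul2n; ring.
- by move=> [[r m] k] /=; rewrite -mul2n; ring.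
Qed.

Lemma mulr_div_ACA (R : comUnitRingType) (a b c d p q r s : R) :
  p \is a GRing.unit -> q \is a GRing.unit ->
  r \is a GRing.unit -> s \is a GRing.unit ->
  a * b * (c * d) / (p * q * (r * s)) = a * c / (p * r) * (b * d / (q * s)).
Proof.
move=> pU qU rU sU.
rewrite [p * q * _]mulrACA invrM ?unitrM ?pU ?qU ?rU ?sU //.
by rewrite [a * b * _]mulrACA [_^-1 * _]mulrC [LHS]mulrACA.
Qed.

Definition summand (n : nat) : fps2 :=
  fpsx ^+ ((3 * n ^ 2 + 3 * n) %/ 2) * fpsy ^+ ((3 * n ^ 2 - 3 * n) %/ 2)
  / (qpoch fpsx (fpsx * fpsy) n
     * qpoch (fpsx ^+ 2 * fpsy ^+ 2) (fpsx ^+ 2 * fpsy ^+ 2) n).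

Lemma summandE n : summand n = \prod_(i < n) factor i.
Proof.
elim: n => [|n IHn].
  rewrite big_ord0.
  have q0 (R : comNzRingType) (a t : R) : qpoch a t 0 = 1 by apply: big_ord0.
  rewrite /summand !q0 (_ : (3 * 0 ^ 2 + 3 * 0) %/ 2 = 0)%N // !expr0.
  by rewrite (mulr1 1) divr1.
rewrite big_ord_recr /= -IHn /summand.
have nS : (n.+1 ^ 2 = n ^ 2 + 2 * n + 1)%N by rewrite -addn1 sqrnD; lia.
(* Guards the truncated subtraction in the exponent of [y]. *)
have n_le : (n <= n ^ 2)%N.
  by rewrite -mulnn; case: n {IHn nS} => // n; rewrite leq_pmulr.
(* The dividend grows by [2 * (3 * n.+1)], and the one for [y] by [2 * (3 * n)], so the quotients
   grow by exactly the exponents in [factor n]. *)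
have -> : ((3 * n.+1 ^ 2 + 3 * n.+1) %/ 2 =
  (3 * n ^ 2 + 3 * n) %/ 2 + 3 * n.+1)%N.
  by rewrite nS [RHS]addnC -divnMDl //; congr (_ %/ 2)%N; lia.
have -> : ((3 * n.+1 ^ 2 - 3 * n.+1) %/ 2 =
  (3 * n ^ 2 - 3 * n) %/ 2 + 3 * n)%N.
  by rewrite nS [RHS]addnC -divnMDl //; congr (_ %/ 2)%N; lia.
have qS (R : comNzRingType) (a t : R) m :
    qpoch a t m.+1 = qpoch a t m * (1 - a * t ^+ m).
  by rewrite /qpoch big_ord_recr.
have e1 : fpsx * (fpsx * fpsy) ^+ n = fpsx ^+ n.+1 * fpsy ^+ n.
  by rewrite exprMn mulrA -exprS.
have e2 : fpsx ^+ 2 * fpsy ^+ 2 * (fpsx ^+ 2 * fpsy ^+ 2) ^+ n =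
    fpsx ^+ (2 * n.+1) * fpsy ^+ (2 * n.+1).
  by rewrite -exprS exprMn -!exprM.
rewrite !qS e1 e2 /factor !exprD.
apply: mulr_div_ACA.
- exact: qpoch_xxy_unit.
- exact: unit_1Bmonomial.
- exact: qpoch_x2y2_unit.
- exact: unit_1Bmonomial.
Qed.

(** * Summation over all lengths *)

(** The infinite sum, cut at [n = a] in the coefficient of [x^a], since later summands do not reach
    that degree. *)
Definition sum_summand : fps2 :=
  Fps (fun b => Fps (fun a => \sum_(n < a.+1) coefxy (summand n) a b)).

Lemma coefxy_summand0 n a b : (a < n)%N -> coefxy (summand n) a b = 0.
Proof.
move=> an; rewrite summandE; have [s [_ mem_s ->]] := enumerates_codes n 0 a b.
case: s mem_s => // r s /(_ r); rewrite inE eqxx /=.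
move=> /esym/and3P[/eqP sr /eqP ra _].
by have := size_code_odd 0 r; rewrite sr ra leqNgt an.
Qed.

Lemma enumerates_codes_lt N :
  enumerates [pred r | size r < N]%N (code_odd 0) (code_even 0)
    (\sum_(n < N) summand n).
Proof.
elim: N => [|N IHN].
  by rewrite big_ord0 => a b; exists [::].
rewrite big_ord_recr /= summandE => a b.
have [r|s [s_uniq mem_s fs]] :=
  enumerates_disjointU _ IHN (enumerates_codes N 0) a b.
  by rewrite /= => /ltn_eqF ->.
exists s; split=> // r; rewrite mem_s !inE /=.
by rewrite ltnS [in RHS]leq_eqVlt orbC.
Qed.

Lemma enumerates_inG' :
  enumerates inG' weight_odd weight_even sum_summand.
Proof.
apply: (enumerates_map (h := decode) (A := predT)
  (u := code_odd 0) (v := code_even 0)).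
- exact: can_inj decodeK.
- move=> l; split=> [|[r _ <-]]; last exact: decode_inG'.
  by exists (encode l) => //; apply: encodeK.
- by move=> r /=; case: (weight_decode r).
- by move=> r /=; case: (weight_decode r).
(* Codes of [x]-exponent [a] have at most [a] pairs, so the bound [a.+1] on the length excludes none
   of them. *)
move=> a b; have [s [s_uniq mem_s fs]] := enumerates_codes_lt a.+1 a b.
exists s; split=> //.
  move=> r; rewrite mem_s !inE /=; case: eqP => [<-|_]; last by rewrite andbF.
  by rewrite ltnS size_code_odd.
rewrite -fs; apply/esym.
exact: (big_morph (fun f => coefxy f a b) (fun f g => coefxyD f g a b)).
Qed.

Theorem theorem5p9 :
  let F (l : seq nat) : fps2 :=
    fpsx ^+ weight_odd l * fpsy ^+ weight_even l in
  let H (n : nat) : fps2 :=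
    fpsx ^+ ((3 * n ^ 2 + 3 * n) %/ 2) * fpsy ^+ ((3 * n ^ 2 - 3 * n) %/ 2)
    / (qpoch fpsx (fpsx * fpsy) n
       * qpoch (fpsx ^+ 2 * fpsy ^+ 2) (fpsx ^+ 2 * fpsy ^+ 2) n) in
  [/\ fps2_summable setG' F,
      fps2_summable [set: nat]%classic H &
      fps2_sum setG' F = fps2_sum [set: nat]%classic H].
Proof.
move=> F H; have setG'E : setG' = [set l | inG' l]%classic.
  by apply/seteqP; split=> l /setG'P.
(* Yields both the summability over G' and the coefficients of the left-hand side. *)
have sumE a b := fsbig_enumerated a b enumerates_inG'.
have H_small n a b : coefxy (H n) a b <> 0 -> (n < a.+1)%N.
  by apply: contra_notT; rewrite -leqNgt; exact: (@coefxy_summand0 n a b).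
split.
- by move=> a b; rewrite setG'E; case: (sumE a b).
- move=> a b.
  apply: (@sub_finite_set _ _ [set` iota 0 a.+1]%classic); last exact: finite_seq.
  move=> n [_ /H_small an]; change (n \in iota 0 a.+1).
  by rewrite mem_iota.
apply: fps2P => a b; rewrite /coefxy /= setG'E; case: (sumE a b) => _.
rewrite /coefxy /= => ->.
(* The support in [n] lies in [0, ..., a], so the right-hand side becomes the finite sum in
   [sum_summand]. *)
rewrite (@fsbigE _ _ _ _ _ (iota 0 a.+1)) ?iota_uniq //.
- rewrite -[iota _ _]/(index_iota 0 a.+1) big_mkord.
  by apply: eq_bigl => i; rewrite in_setT.
- move=> n _; apply: contraNeq => /eqP/H_small an; rewrite mem_iota; exact: an.
Qed.
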